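(* Let $p$ and $q$ be positive rational primes. Then: (1) $\mathcal{F}_p=\mathcal{F}_q$ if and only if $p=q$. (2) Given any prime $p$, there exist infinitely many PPI-polynomials $f$ that attain the value $p$ at some integer but such that no translate $f(x-b)$, $b\in\mathbb{Z}$, is in $\mathcal{F}_p$. (3) The Bouniakowsky Hypothesis (BH) holds if and only if every PPI-polynomial $f$ belongs to $\mathcal{F}_p$ for some prime $p$.
   Context: A polynomial in $\mathbb{Z}[x]$ is positive if its leading coefficient is positive; a non-constant polynomial in $\mathbb{Z}[x]$ is proper if the gcd of its values at all integers is $1$; a PPI-polynomial is a (non-constant) positive, proper polynomial irreducible in $\mathbb{Z}[x]$. Every positive polynomial $g$ has a unique base-$x$ representation $\sum_{i=0}^m b_i(x)x^i$ with digits $b_i(x)\in\{0,1,2,\dots\}\cup\{x-1,x-2,\dots\}$, $b_m(x)\ne0$; $\mathrm{MB}(g)$ is the least positive integer $a$ such that all its digits lie in $\{0,\dots,a-1\}\cup\{x-1,\dots,x-a\}$. For a prime $p$, $\mathcal{F}_p$ is the set consisting of the constant polynomial $p$, the cyclotomic polynomial $\Phi_p(x)=x^{p-1}+\cdots+x+1$, and every PPI-polynomial $g(x)\in\mathbb{Z}[x]$ such that $g(b)=p$ for some integer $b\ge\mathrm{MB}(g)$. Bouniakowsky Hypothesis (BH): for every proper irreducible polynomial $f(x)\in\mathbb{Z}[x]$ with positive leading coefficient, $f(n)$ takes prime values for infinitely many positive integers $n$. *)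

(* Defs.v *)
From mathcomp Require Import all_boot all_order all_algebra all_field.
From mathcomp Require Import boolp classical_sets functions cardinality.
From mathcomp Require Import lra zify ring.

Set Implicit Arguments.
Unset Strict Implicit.
Unset Printing Implicit Defensive.

Import Order.TTheory GRing.Theory Num.Theory.

Local Open Scope classical_set_scope.
Local Open Scope ring_scope.

Definition positive_poly (g : {poly int}) : Prop := 0 < lead_coef g.

Definition proper_poly (g : {poly int}) : Prop :=
  (1 < size g)%N /\
  forall d : nat, (forall n : int, (d%:Z %| g.[n])%Z) -> d = 1%N.

(* Irreducibility in the ring Z[x]. The library's [irreducible_poly] is
   irreducibility over the fraction field: it also accepts, e.g., 2x. *)
Definition irreducible_Zx (g : {poly int}) : Prop :=
  [/\ g != 0, g \isn't a GRing.unit &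
      forall u v : {poly int}, g = u * v ->
        u \is a GRing.unit \/ v \is a GRing.unit].

Definition PPI (g : {poly int}) : Prop :=
  [/\ positive_poly g, proper_poly g & irreducible_Zx g].

Definition digit : set {poly int} :=
  [set d | exists c : nat, d = c%:R \/ d = 'X - c.+1%:R].

Definition digit_below (a : nat) : set {poly int} :=
  [set d | exists2 c : nat, (c < a)%N & d = c%:R \/ d = 'X - c.+1%:R].

(* The digits are listed from b_0 to b_m; the condition on [last] says that
   the list is nonempty and b_m != 0. *)
Definition base_x_rep (g : {poly int}) (s : seq {poly int}) : Prop :=
  [/\ forall d, d \in s -> digit d, last 0 s != 0 &
      g = \sum_(i < size s) s`_i * 'X^i].

Definition is_MB (g : {poly int}) (a : nat) : Prop :=
  exists s : seq {poly int}, base_x_rep g s /\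
    [/\ (0 < a)%N, forall d, d \in s -> digit_below a d &
        forall a' : nat, (0 < a')%N ->
          (forall d, d \in s -> digit_below a' d) -> (a <= a')%N].

(* For positive g, this is the only a such that [is_MB g a] (see [MBP]). *)
Definition MB (g : {poly int}) : nat := xget 0%N [set a | is_MB g a].

Definition calF (p : nat) : set {poly int} :=
  [set g | g = p%:R \/ g = 'Phi_p \/
     (PPI g /\ exists2 b : int, (MB g)%:Z <= b & g.[b] = p%:Z)].

Definition BH : Prop :=
  forall f : {poly int}, proper_poly f -> irreducible_Zx f ->
    positive_poly f ->
    infinite_set [set n : nat | (0 < n)%N /\
      exists2 r : nat, prime r & f.[n%:Z] = r%:Z].

Lemma Cyclotomic_prime (p : nat) :
  prime p -> 'Phi_p = \sum_(i < p) 'X^i :> {poly int}.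
Proof.
move=> pp; have p0 := prime_gt0 pp.
have X1 : ('X - 1 : {poly int}) != 0 by rewrite -polyC1 polyXsubC_eq0.
have P1 : 'Phi_1 = 'X - 1.
  by have := prod_Cyclotomic (ltn0Sn 0); rewrite big_cons big_nil mulr1 expr1.
apply: (mulfI X1); rewrite -subrX1 -(prod_Cyclotomic p0).
have -> : divisors p = [:: 1%N; p].
  apply: (@irr_sorted_eq _ ltn ltn_trans ltnn); first exact: sorted_divisors_ltn.
    by rewrite /= prime_gt1.
  move=> d; rewrite -dvdn_divisors // !inE.
  apply/idP/idP => [/(primeP pp).2 //|/orP[] /eqP-> //]; exact: dvd1n.
by rewrite !big_cons big_nil mulr1 P1.
Qed.

Lemma horner0_sum (s : seq {poly int}) :
  (\sum_(i < size s) s`_i * 'X^i).[0] = (head 0 s).[0].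
Proof.
case: s => [|d s]; first by rewrite big_ord0.
rewrite /= big_ord_recl /= expr0 mulr1 hornerD horner_sum big1 ?addr0 // => i _.
by rewrite hornerM hornerXn expr0n mulr0.
Qed.

Lemma sum_cons (d : {poly int}) s :
  \sum_(i < size (d :: s)) (d :: s)`_i * 'X^i =
  d + 'X * \sum_(i < size s) s`_i * 'X^i.
Proof.
rewrite /= big_ord_recl /= expr0 mulr1; congr (_ + _).
by rewrite big_distrr /=; apply: eq_bigr => i _; rewrite exprS mulrCA.
Qed.

Lemma natr_horner (c : nat) (x : int) : (c%:R : {poly int}).[x] = c%:Z.
Proof. by rewrite -polyC_natr hornerC natz. Qed.

Lemma digit_horner0_inj (d e : {poly int}) :
  digit d -> digit e -> d.[0] = e.[0] -> d = e.
Proof.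
move=> [c [->|->]] [k [->|->]];
  rewrite ?hornerD ?hornerN ?hornerX !natr_horner => H.
- by have -> : c = k by lia.
- by exfalso; lia.
- by exfalso; lia.
- by have -> : c = k by lia.
Qed.

(* Like [base_x_rep], but 0 also gets a representation, the empty one. *)
Definition rep0 (g : {poly int}) (s : seq {poly int}) : Prop :=
  [/\ forall d, d \in s -> digit d, last 1 s != 0 &
      g = \sum_(i < size s) s`_i * 'X^i].

Lemma rep0_cons g d s : rep0 g (d :: s) ->
  [/\ digit d, rep0 (\sum_(i < size s) s`_i * 'X^i) s &
      g = d + 'X * \sum_(i < size s) s`_i * 'X^i].
Proof.
move=> [D L E]; split; last by rewrite E sum_cons.
  by apply: D; rewrite mem_head.
split=> // [e es|]; first by apply: D; rewrite inE es orbT.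
by case: s L {D E} => [|e s] //=; rewrite oner_eq0.
Qed.

Lemma digit0 : digit 0.
Proof. by exists 0%N; left. Qed.

Lemma rep0_0 s : rep0 0 s -> s = [::].
Proof.
elim: s => // d s IH H; have [Dd Hs E] := rep0_cons H.
have d0 : d = 0.
  apply: digit_horner0_inj Dd digit0 _; rewrite horner0.
  by have := congr1 (horner^~ 0) E; rewrite /= hornerD hornerM hornerX mul0r addr0 horner0.
move: E; rewrite d0 add0r => /esym/eqP; rewrite mulf_eq0 polyX_eq0 /= => /eqP E.
rewrite E in Hs; move: H; rewrite (IH Hs) d0 => -[_ /=].
by rewrite eqxx.
Qed.

Lemma rep0_unique g s t : rep0 g s -> rep0 g t -> s = t.
Proof.
elim: s g t => [|d s IH] g t Hs Ht.
  by case: Hs => _ _; rewrite big_ord0 => g0; rewrite g0 in Ht; rewrite (rep0_0 Ht).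
case: t Ht => [|e t] Ht.
  by case: Ht => _ _; rewrite big_ord0 => g0; rewrite g0 in Hs; have := rep0_0 Hs.
have [Dd Hs' Es] := rep0_cons Hs; have [De Ht' Et] := rep0_cons Ht.
have de : d = e.
  apply: digit_horner0_inj => //.
  have := congr1 (horner^~ 0) Es; have := congr1 (horner^~ 0) Et.
  by rewrite /= !hornerD !hornerM hornerX !mul0r !addr0 => -> ->.
move: Et; rewrite Es de => /addrI /(mulfI (negbT (polyX_eq0 _))) E.
by rewrite -E in Ht'; rewrite (IH _ _ Hs' Ht').
Qed.

Lemma base_x_rep_rep0 g s : base_x_rep g s -> rep0 g s.
Proof. by case=> D L E; split=> //; case: s L {D E} => [|d s] //=; rewrite eqxx. Qed.

Lemma base_x_rep_unique g s t : base_x_rep g s -> base_x_rep g t -> s = t.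
Proof. by move=> /base_x_rep_rep0 Hs /base_x_rep_rep0; exact: rep0_unique. Qed.

Lemma rep0_step d g1 s : digit d -> rep0 g1 s -> d + 'X * g1 != 0 ->
  exists t, rep0 (d + 'X * g1) t.
Proof.
move=> Dd [D L E] N; exists (d :: s); split; last by rewrite sum_cons -E.
  by move=> e; rewrite inE => /orP[/eqP->|/D].
case: s L E {D} => [|e s] //= _; rewrite big_ord0 => E.
by move: N; rewrite E mulr0 addr0.
Qed.

Lemma lead_coef_subr1_ge0 (h : {poly int}) :
  0 < lead_coef h -> 0 <= lead_coef (h - 1).
Proof.
have [sh|sh] := leqP (size h) 1%N.
  rewrite (size1_polyC sh) -polyCB !lead_coefC; lia.
by rewrite lead_coefDl ?size_polyN ?size_poly1 // => /ltW.
Qed.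

Lemma size_subr1 (h : {poly int}) : h != 0 -> (size (h - 1)%R <= size h)%N.
Proof.
move=> h0; apply: leq_trans (size_polyD _ _) _.
by rewrite size_polyN size_poly1 geq_max leqnn size_poly_gt0.
Qed.

Lemma rep0_nil : rep0 0 [::].
Proof. by split; rewrite ?big_ord0 //= oner_eq0. Qed.

Lemma rep0_exists g : 0 <= lead_coef g -> exists s, rep0 g s.
Proof.
move: {2}(size g) (leqnn (size g)) => n; elim: n g => [|n IH] g.
  by rewrite leqn0 size_poly_eq0 => /eqP-> _; exists [::]; exact: rep0_nil.
have [->|gn0] := eqVneq g 0; first by exists [::]; exact: rep0_nil.
elim/poly_ind: g gn0 => [|h c _]; first by rewrite eqxx.
move=> gn0; rewrite size_MXaddC.
have Lh : h != 0 -> lead_coef (h * 'X + c%:P) = lead_coef h.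
  move=> h0; rewrite lead_coefDl ?lead_coefMX // size_polyC size_mulX //.
  by rewrite ltnS; apply: leq_trans (leq_b1 _) _; rewrite size_poly_gt0.
have c_nat : 0 <= c -> digit c%:P.
  by move=> c0; exists `|c|%N; left; rewrite -polyC_natr natz gez0_abs.
have [h0|h0] := eqVneq h 0.
  move=> _; move: gn0; rewrite h0 mul0r add0r lead_coefC => gn0 /c_nat Dc.
  have := rep0_step Dc rep0_nil; rewrite mulr0 addr0; exact.
rewrite Lh //= ltnS => sh lh.
have lh1 : 0 < lead_coef h by rewrite lt_def lead_coef_eq0 h0.
have [c0|c0] := leP 0 c.
  have [s Hs] := IH _ sh lh; have := rep0_step (c_nat c0) Hs.
  by rewrite addrC mulrC in gn0 *; exact.
have [s Hs] := IH _ (leq_trans (size_subr1 h0) sh) (lead_coef_subr1_ge0 lh1).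
have Dc : digit ('X + c%:P).
  exists `|c|.-1; right; rewrite prednK ?absz_gt0 ?lt_eqF //.
  by rewrite -polyC_natr natz ltz0_abs // polyCN opprK.
have Eg : 'X + c%:P + 'X * (h - 1) = h * 'X + c%:P by ring.
by have := rep0_step Dc Hs; rewrite Eg; exact.
Qed.

Lemma base_x_rep_exists g : positive_poly g -> exists s, base_x_rep g s.
Proof.
move=> g0; have [s [D L E]] := rep0_exists (ltW g0); exists s; split=> //.
case: s L E {D} => [|d s] //= _; rewrite big_ord0 => g00.
by move: g0; rewrite /positive_poly g00 lead_coef0 ltxx.
Qed.

Lemma digit_below_le a b d : (a <= b)%N -> digit_below a d -> digit_below b d.
Proof. by move=> ab [c ca Hc]; exists c => //; apply: leq_trans ab. Qed.

Lemma digits_bounded (s : seq {poly int}) : (forall d, d \in s -> digit d) ->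
  exists a, (0 < a)%N /\ forall d, d \in s -> digit_below a d.
Proof.
elim: s => [|d s IH] D; first by exists 1%N.
have [e es|a [a0 Ha]] := IH; first by apply: D; rewrite inE es orbT.
have [c Hc] := D d (mem_head _ _).
exists (maxn a c.+1); split=> [|e]; first by rewrite leq_max a0.
rewrite inE => /orP[/eqP->|/Ha]; last exact/digit_below_le/leq_maxl.
by exists c => //; rewrite leq_maxr.
Qed.

Lemma is_MB_exists g : positive_poly g -> exists a, is_MB g a.
Proof.
move=> /base_x_rep_exists[s Hs]; have [D _ _] := Hs.
pose P a := `[< (0 < a)%N /\ forall d, d \in s -> digit_below a d >].
have exP : exists a, P a by have [a Ha] := digits_bounded D; exists a; exact/asboolP.
case: (ex_minnP exP) => a /asboolP[a0 Ha] m; exists a, s; split=> //; split=> //.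
by move=> b b0 Hb; apply: m; exact/asboolP.
Qed.

Lemma is_MB_unique g a b : is_MB g a -> is_MB g b -> a = b.
Proof.
move=> [s [Hs [a0 Ha ma]]] [t [Ht [b0 Hb mb]]].
rewrite -(base_x_rep_unique Hs Ht) in Hb mb.
by apply/eqP; rewrite eqn_leq ma // mb.
Qed.

Lemma MBP g a : positive_poly g -> MB g = a <-> is_MB g a.
Proof.
move=> /is_MB_exists exM; have MM : is_MB g (MB g) := xgetPex 0%N exM.
by split=> [<-//|]; exact: is_MB_unique.
Qed.

(* Main.v *)
(* (1) The constant p is the only constant in F_p.
   (2) For a = kp + 1 with k > 0, the translate a(x - b) + p takes the value p
   only at b, while its digits force MB > b.
   (3) Applied to the translates f(x + N), whose values at the positive integers
   are those of f beyond N, membership in some F_p gives a prime value f(n) with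
   n > N; in the case of the polynomial Phi_p, the prime value is Phi_p(1). *)
Require Import Defs.
From mathcomp Require Import all_boot all_order all_algebra all_field.
From mathcomp Require Import boolp classical_sets functions cardinality.
From mathcomp Require Import zify ring.

Set Implicit Arguments.
Unset Strict Implicit.
Unset Printing Implicit Defensive.

Import Order.TTheory GRing.Theory Num.Theory.

Local Open Scope classical_set_scope.
Local Open Scope ring_scope.

Lemma infinite_set_natP (A : set nat) :
  infinite_set A <-> forall N, exists2 n, (N <= n)%N & A n.
Proof.
split=> [infA N|unbA /finite_seqP[s As]].
  apply: contrapT => noA; apply: infA.
  apply: (sub_finite_set _ (finite_II N)) => n An /=.
  by rewrite ltnNge; apply/negP => Nn; apply: noA; exists n.
have [n] := unbA (\max_(i <- s) i).+1; rewrite As /= => lt_s n_s.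
by have := @leq_bigmax_seq _ s xpredT (fun i => i) n n_s isT; rewrite leqNgt lt_s.
Qed.

(** * Translates of PPI-polynomials *)

Lemma comp_translateK (b : int) (f : {poly int}) :
  (f \Po ('X + b%:P)) \Po ('X - b%:P) = f.
Proof.
by rewrite -comp_polyA comp_polyD comp_polyX comp_polyC subrK comp_polyXr.
Qed.

Lemma size_translate (b : int) (f : {poly int}) :
  size (f \Po ('X + b%:P)) = size f.
Proof. by rewrite size_comp_poly2 // size_XaddC. Qed.

Lemma horner_translate (b n : int) (f : {poly int}) :
  (f \Po ('X + b%:P)).[n] = f.[n + b].
Proof. by rewrite horner_comp hornerD hornerX hornerC. Qed.

(** Composition with ['X + b] is a ring automorphism with inverse composition with ['X - b], so
    units and factorizations transport both ways. *)
Lemma irreducible_translate (b : int) (f : {poly int}) :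
  irreducible_Zx f -> irreducible_Zx (f \Po ('X + b%:P)).
Proof.
case=> f0 fU fI; split.
- by rewrite comp_poly2_eq0 // size_XaddC.
- apply: contra fU => /(rmorph_unit (comp_poly ('X - b%:P))).
  by rewrite /= comp_translateK.
move=> u v Euv.
have E : f = (u \Po ('X - b%:P)) * (v \Po ('X - b%:P)).
  by rewrite -comp_polyM -Euv comp_translateK.
have unitK w : w \Po ('X - b%:P) \is a GRing.unit -> w \is a GRing.unit.
  move=> /(rmorph_unit (comp_poly ('X + b%:P))) /=.
  by have := comp_translateK (- b) w; rewrite polyCN opprK => ->.
by case: (fI _ _ E) => /unitK; [left|right].
Qed.

Lemma PPI_translate (b : int) (f : {poly int}) :
  PPI f -> PPI (f \Po ('X + b%:P)).
Proof.
case=> f_pos [sf f_gcd] f_irr; split; last exact: irreducible_translate.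
  rewrite /positive_poly lead_coef_comp ?size_XaddC //.
  by rewrite lead_coefXaddC expr1n mulr1.
split=> [|d dv]; first by rewrite size_translate.
apply: f_gcd => n; have := dv (n - b).
by rewrite horner_translate subrK.
Qed.

(** * Linear PPI-polynomials *)

Lemma size_linear (a b : int) : a != 0 -> size (a%:P * 'X + b%:P) = 2%N.
Proof. by move=> a0; rewrite size_MXaddC polyC_eq0 (negPf a0) size_polyC a0. Qed.

Lemma lead_coef_linear (a b : int) : a != 0 -> lead_coef (a%:P * 'X + b%:P) = a.
Proof.
by move=> a0; rewrite lead_coefE size_linear //= coefD coefMX !coefC /= addr0.
Qed.

Lemma horner_linear (a b n : int) : (a%:P * 'X + b%:P).[n] = a * n + b.
Proof. by rewrite hornerMXaddC hornerC. Qed.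

Lemma coprimez_dvdz_absz (a b d : int) :
  coprimez a b -> (d %| a)%Z -> (d %| b)%Z -> `|d|%N = 1%N.
Proof.
move=> /eqP ab da db; have: (d %| gcdz a b)%Z by rewrite dvdz_gcd da.
by rewrite ab dvdz1 => /eqP.
Qed.

(** By degrees one factor is a constant; it divides both [a] and [b], hence is 1 or -1. *)
Lemma irreducible_linear (a b : int) :
  a != 0 -> coprimez a b -> irreducible_Zx (a%:P * 'X + b%:P).
Proof.
move=> a0 ab; set f := _ + _; have sf : size f = 2%N := size_linear b a0.
have f0 : f != 0 by rewrite -size_poly_gt0 sf.
split=> // [|u v fuv]; first by rewrite poly_unitE sf.
have constU (c w : {poly int}) : f = c * w -> size c = 1%N -> c \is a GRing.unit.
  move=> fcw /eqP/size_poly1P[k _ Ec]; rewrite Ec in fcw *; apply: rmorph_unit.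
  have k1 : `|k|%N = 1%N.
    apply: (coprimez_dvdz_absz ab); apply/dvdzP.
      exists w`_1; have := congr1 (fun p : {poly int} => p`_1) fcw.
      by rewrite coefD coefMX !coefC /= addr0 coefCM mulrC.
    exists w`_0; have := congr1 (fun p : {poly int} => p`_0) fcw.
    by rewrite coefD coefMX !coefC /= add0r coefCM mulrC.
  by have [->|->] : k = 1 \/ k = -1 by lia.
have: u * v != 0 by rewrite -fuv.
rewrite mulf_eq0 negb_or => /andP[u0 v0].
have suv : (size u + size v = 3)%N.
  (* [size_mul] gives the predecessor of [size u + size v]; that sum is positive because [u != 0],
     so the predecessor can be undone. *)
  have := size_mul u0 v0; rewrite -fuv sf => E.
  by rewrite -[LHS]prednK -?E // addn_gt0 size_poly_gt0 u0.
move: u0 v0; rewrite -!size_poly_gt0 => u0 v0.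
have [su|sv] : size u = 1%N \/ size v = 1%N.
  by move: (size u) (size v) suv u0 v0 => m n; lia.
- by left; exact: constU fuv su.
- by right; apply: constU sv; rewrite mulrC fuv.
Qed.

Lemma PPI_linear (a b : int) : 0 < a -> coprimez a b -> PPI (a%:P * 'X + b%:P).
Proof.
move=> a_gt0 ab; have a0 : a != 0 by rewrite gt_eqF.
split; last exact: irreducible_linear.
  by rewrite /positive_poly lead_coef_linear.
split=> [|d dv]; first by rewrite size_linear.
(* The values at 0 and 1 are [b] and [a + b], whose gcd is already 1. *)
have db := dv 0; have dab := dv 1.
rewrite horner_linear mulr0 add0r in db; rewrite horner_linear mulr1 in dab.
have da : (d%:Z %| a)%Z by rewrite -[a](addrK b) rpredB.
exact: coprimez_dvdz_absz ab da db.
Qed.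

(** * Lower bounds for [MB] *)

Lemma MB_gt0 (g : {poly int}) : positive_poly g -> (0 < MB g)%N.
Proof. by move=> g0; have [s [_ []]] := (MBP (MB g) g0).1 erefl. Qed.

(** Since the representation is unique, any explicit list of digits of [g] bounds [MB g] from
    below. *)
Lemma digit_below_MB (g : {poly int}) s d :
  positive_poly g -> base_x_rep g s -> d \in s -> digit_below (MB g) d.
Proof.
move=> g0 Hs; have [t [Ht [_ + _]]] := (MBP (MB g) g0).1 erefl.
by rewrite (base_x_rep_unique Hs Ht); exact.
Qed.

(** Evaluation at 0 separates the two kinds of digits: it is nonnegative on the constants and
    negative on ['X - c.+1%:R]. *)
Lemma digit_below_nat (a c : nat) : digit_below a c%:R -> (c < a)%N.
Proof.
case=> k ka [] /(congr1 (horner^~ 0));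
  rewrite /= ?hornerD ?hornerN ?hornerX !natr_horner; lia.
Qed.

Lemma digit_below_XsubC (a c : nat) : digit_below a ('X - c.+1%:R) -> (c < a)%N.
Proof.
case=> k ka [] /(congr1 (horner^~ 0));
  rewrite /= ?hornerD ?hornerN ?hornerX !natr_horner; lia.
Qed.

(* For [b > 0] the digits are [x - (a b - p)] and [a - 1], so that
   [MB >= max(a, a b - p)], which exceeds [b] because [p < a]. *)
Lemma MB_linear_gt (a p : nat) (b : int) :
  (1 < p)%N -> (p < a)%N -> b < (MB (a%:Z%:P * 'X + (p%:Z - a%:Z * b)%:P))%:Z.
Proof.
move=> p1 pa; set g := _ + _.
have g_pos : positive_poly g by rewrite /positive_poly lead_coef_linear; lia.
have M0 := MB_gt0 g_pos.
(* If [p - a b >= 0], then [a b <= p < a], so [b <= 0 < MB g]. *)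
have [c0|c0] := leP 0 (p%:Z - a%:Z * b).
  by have [|b0] := leP b 0; first lia; nia.
pose c := `|(p%:Z - a%:Z * b)%R|%N.-1.
have Ec : p%:Z - a%:Z * b = - c.+1%:Z by rewrite /c; lia.
have rep_g : base_x_rep g [:: 'X - c.+1%:R; a.-1%:R].
  split.
  - move=> d; rewrite !inE => /orP[]/eqP->; [by exists c; right|by exists a.-1; left].
  - by rewrite /= -polyC_natr polyC_eq0 natz; lia.
  - rewrite /g Ec !big_ord_recl big_ord0 /= expr0 mulr1 addr0 expr1.
    rewrite -!polyC_natr !natz polyCN.
    have -> : a%:Z = a.-1%:Z + 1 by lia.
    by rewrite polyCD; ring.
have c_lt : (c < MB g)%N.
  by apply: digit_below_XsubC; apply: (digit_below_MB g_pos rep_g); rewrite !inE eqxx.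
have a_lt : (a.-1 < MB g)%N.
  by apply: digit_below_nat; apply: (digit_below_MB g_pos rep_g); rewrite !inE eqxx orbT.
(* If [b < a], the digit [a - 1] suffices. If [b >= a], then [(a - 1) b >= p b > p], that is,
   [a b - p > b]. *)
have [|aM] := ltP b a%:Z; first lia.
nia.
Qed.

Lemma linear_translate_notin_calF (a p : nat) (b : int) :
  prime p -> (p < a)%N ->
  ~ calF p ((a%:Z%:P * 'X + p%:Z%:P) \Po ('X - b%:P)).
Proof.
move=> p_pr pa; have p1 := prime_gt1 p_pr.
have -> : (a%:Z%:P * 'X + p%:Z%:P) \Po ('X - b%:P) =
          a%:Z%:P * 'X + (p%:Z - a%:Z * b)%:P.
  by rewrite comp_poly_MXaddC comp_polyC polyCB polyCM; ring.
have a0 : a%:Z != 0 by lia.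
case=> [Eg|[Eg|[_ [c cM]]]].
- have := size_linear (p%:Z - a%:Z * b) a0.
  by rewrite Eg -polyC_natr size_polyC; case: (_ != _).
(* ['Phi_p] is monic, whereas [a > p > 1]. *)
- have := lead_coef_linear (p%:Z - a%:Z * b) a0.
  by rewrite Eg (monicP (Cyclotomic_monic p)); lia.
- rewrite horner_linear => Ec.
  have cb : c = b by apply: (mulfI a0); lia.
  by have := MB_linear_gt b p1 pa; rewrite -cb in cM *; lia.
Qed.

(** * The three claims *)

Lemma horner1_Cyclotomic_prime (p : nat) : prime p -> ('Phi_p).[1] = p%:Z.
Proof.
move=> p_pr; rewrite Cyclotomic_prime // horner_sum.
under eq_bigr do rewrite hornerXn expr1n.
by rewrite sumr_const card_ord natz.
Qed.

Lemma calF_inj (p q : nat) : prime p -> prime q -> calF p = calF q -> p = q.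
Proof.
move=> p_pr q_pr Epq; have: calF p p%:R by left.
have sp : size (p%:R : {poly int}) = 1%N.
  by rewrite -polyC_natr size_polyC natz; have := prime_gt0 p_pr; case: p {p_pr Epq}.
rewrite Epq => -[E|[E|[[_ [gt1 _] _] _]]].
- by have := congr1 (horner^~ 0) E; rewrite /= !natr_horner; case.
(* ['Phi_q] has size [totient q + 1 = q > 1], so it is not constant. *)
- by have := size_Cyclotomic q; rewrite -E sp totient_prime //; have := prime_gt1 q_pr; lia.
- by rewrite sp in gt1.
Qed.

Lemma infinite_no_translate_in_calF (p : nat) : prime p ->
  infinite_set [set f : {poly int} |
    [/\ PPI f, exists n : int, f.[n] = p%:Z &
        forall b : int, ~ calF p (f \Po ('X - b%:P))]].
Proof.
move=> p_pr; have p1 := prime_gt1 p_pr.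
set A := [set f | _].
suff [F] : $|{injfun [set: nat] >-> A}| by apply/infiniteP; exact: inj_card_le F.
apply/injfunPex.
(* The leading coefficient [(k + 1) p + 1] is coprime to [p], exceeds [p] and determines [k]; the
   value [p] is taken at 0. *)
exists (fun k : nat => (k.+1 * p).+1%:Z%:P * 'X + p%:Z%:P) => [k _|k l _ _] /=.
  split; last by move=> b; apply: linear_translate_notin_calF => //; nia.
    apply: PPI_linear => //; rewrite coprimezE /= coprime_sym.
    by rewrite /coprime -addn1 gcdnMDl gcdn1.
  by exists 0; rewrite horner_linear mulr0 add0r.
move=> /(congr1 (lead_coef : {poly int} -> int)); rewrite !lead_coef_linear //.
nia.
Qed.

Lemma BHP :
  BH <-> forall f : {poly int}, PPI f -> exists2 p : nat, prime p & calF p f.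
Proof.
split=> [bh f f_ppi | allF f f_prop f_irr f_pos].
  have [f_pos f_prop f_irr] := f_ppi.
  (* Infinitely many prime values include one at some [n >= MB f], as membership requires. *)
  have /infinite_set_natP/(_ (MB f))[n Mn [_ [r r_pr fn]]] := bh f f_prop f_irr f_pos.
  by exists r => //; right; right; split=> //; exists n%:Z.
apply/infinite_set_natP => N.
have g_ppi := PPI_translate N%:Z (And3 f_pos f_prop f_irr).
have [p p_pr Fg] := allF _ g_ppi.
(* A prime value of the translate at [c > 0] is the value of [f] at [c + N]. In the generic case of
   [calF], [c >= MB > 0]. *)
suff [c c0 gc] : exists2 c : int, 0 < c & (f \Po ('X + N%:Z%:P)).[c] = p%:Z.
  exists (`|c| + N)%N; [exact: leq_addl|split; [lia|exists p => //]].
  by rewrite -gc horner_translate PoszD gtz0_abs.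
have [g_pos [sg _] _] := g_ppi.
case: Fg => [Eg|[Eg|[_ [c cM gc]]]].
- by move: sg; rewrite Eg -polyC_natr size_polyC; case: (_ != _).
- by exists 1 => //; rewrite Eg horner1_Cyclotomic_prime.
- by exists c => //; have := MB_gt0 g_pos; lia.
Qed.

Theorem theorem8 :
  (forall p q : nat, prime p -> prime q -> (calF p = calF q <-> p = q)) /\
  (forall p : nat, prime p ->
     infinite_set [set f : {poly int} |
       [/\ PPI f, exists n : int, f.[n] = p%:Z &
           forall b : int, ~ calF p (f \Po ('X - b%:P))]]) /\
  (BH <-> forall f : {poly int}, PPI f -> exists2 p : nat, prime p & calF p f).
Proof.
split; last by split; [exact: infinite_no_translate_in_calF|exact: BHP].
by move=> p q p_pr q_pr; split=> [|-> //]; exact: calF_inj.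
Qed.
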